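(* Let $p>q$ be positive integers and let $\beta>0$. Consider index difference $\triangle n=2$ and set $$R(\gamma)=\beta\left[2^{2p}s_{2p+1}(\gamma)-1\right]-\left[2^{2q}s_{2q+1}(\gamma)-1\right],\qquad \beta_0^{(\triangle n=2)}=\frac{2^{2q}-1}{2^{2p}-1},\qquad \beta_{-1/4}^{(\triangle n=2)}=\frac{(2q+1)2q}{(2p+1)2p},$$ where $s_0=2$, $s_1=1$, $s_{m+1}(\gamma)=s_m(\gamma)+\gamma s_{m-1}(\gamma)$ for $m\ge1$. For the linearized problem $v_t=cv_x+Av_{(2q+1)x}+Bv_{(2p+1)x}$ at zero amplitude with $c=c_1=\beta-1$, where $A(-1)^q=1$ and $-B(-1)^p=\beta$, the presence and character of collisions of eigenvalues whose Fourier indices differ by $\triangle n=2$ are as follows. (i) For $\beta<\beta_0^{(\triangle n=2)}$, eigenvalues of the same signature collide, i.e., there is a root $\gamma>0$ of $R(\gamma)=0$, and there is no root $\gamma\in(-1/4,0)$. (ii) For $\beta_0^{(\triangle n=2)}<\beta<\beta_{-1/4}^{(\triangle n=2)}$, eigenvalues of opposite signature collide, i.e., there is a root $\gamma\in(-1/4,0)$ of $R(\gamma)=0$. (iii) For $\beta_{-1/4}^{(\triangle n=2)}<\beta$, eigenvalues do not collide, i.e., all real roots $\gamma$ of $R(\gamma)=0$ satisfy $\gamma\le-1/4$.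
   Context: The linearized problem arises from $u_t=\partial_xf(u)+A\,\partial_x^{2q+1}u+B\,\partial_x^{2p+1}u$ with $2\pi$-periodic boundary conditions, in a frame moving with velocity $c$; $v_{(m)x}$ denotes $\partial_x^mv$. Its dispersion relation, with $\alpha=A(-1)^q$ normalized to $1$ and $\beta=-B(-1)^p$, is $\Omega(k)=-ck-k^{2q+1}+\beta k^{2p+1}$. The value $c=c_1=\beta-1$ is chosen so that $\Omega(1)=0$. The eigenvalues are $\lambda_n^{(\tilde\mu)}=-i\Omega(n+\tilde\mu)$, $n\in\mathbb{Z}$, $\tilde\mu\in(-1/2,1/2]$. With $\mu=n_2+\tilde\mu$ and $n_1-n_2=2$, the collision condition $\lambda_{n_1}^{(\tilde\mu)}=\lambda_{n_2}^{(\tilde\mu)}$ is $\Omega(\mu+2)=\Omega(\mu)$, and $\Omega(\mu+2)-\Omega(\mu)=2R(\gamma)$ with $\gamma=\mu(\mu+2)/4$. The Krein signature of a nonzero $\lambda_n^{(\tilde\mu)}$ is $-\operatorname{sign}\left(\Omega(n+\tilde\mu)/(n+\tilde\mu)\right)$. For $\triangle n=2$, $\gamma=-1/4$ is a root of $R$ for all $\beta$, corresponding to the collision $\Omega(-1)=0=\Omega(1)$ at the origin; this collision, due to symmetries, is disregarded. Convention: apart from it, ''collision of eigenvalues of opposite (same) signature'' means that $R$ has a real root $\gamma\in(-1/4,0)$ (respectively $\gamma>0$); real $\mu$ corresponds to real $\gamma\ge-1/4$. The precise content of each item is the statement after ''i.e.''. *)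

(* Defs.v *)
From mathcomp Require Import all_boot all_order all_algebra.
From mathcomp Require Import reals.

Set Implicit Arguments.
Unset Strict Implicit.
Unset Printing Implicit Defensive.

Import Order.TTheory GRing.Theory Num.Theory.
Local Open Scope ring_scope.

Fixpoint s (K : realType) (m : nat) (g : K) {struct m} : K :=
  match m with
  | 0 => 2
  | 1 => 1
  | (m''.+1 as m').+1 => s m' g + g * s m'' g
  end.

(* With Omega k = - (b - 1) k - k ^+ (2q+1) + b * k ^+ (2p+1), the collision
   condition for index difference 2 reads
     Omega (mu + 2) - Omega mu = 2 * collR p q b (mu (mu + 2) / 4) = 0,
   because s m g = a ^+ m + c ^+ m whenever a + c = 1 and a * c = - g; take
   a = (mu + 2) / 2, c = - mu / 2 and g = mu (mu + 2) / 4. *)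
Definition collR (K : realType) (p q : nat) (b g : K) : K :=
  b * (2 ^+ (2 * p) * s (2 * p + 1) g - 1)
  - (2 ^+ (2 * q) * s (2 * q + 1) g - 1).

Definition beta_zero (K : realType) (p q : nat) : K :=
  (2 ^+ (2 * q) - 1) / (2 ^+ (2 * p) - 1).

(* The value of b at which - 1 / 4 is a multiple root of collR p q b. *)
Definition beta_quarter (K : realType) (p q : nat) : K :=
  ((2 * q + 1) * (2 * q))%:R / ((2 * p + 1) * (2 * p))%:R.

(* Main.v *)
(* In the variable x = 1 + 4 g >= 0, Binet's formula with t = sqrt x gives
   2^(2n) s_(2n+1)(g) - 1 = sum_(1 <= j <= n) 'C(2n+1, 2j) x^j, so collR is x
   times a polynomial whose coefficients beta 'C(2p+1, 2j) - 'C(2q+1, 2j)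
   change sign at most once, from negative to positive. Its value at x = 0
   compares beta with beta_quarter, its value at x = 1 (that is g = 0) compares
   beta with beta_zero, and a single sign change forbids a root in (0, 1) when
   the value at 1 is negative. *)
Require Import Defs.
From mathcomp Require Import all_boot all_order all_algebra.
From mathcomp Require Import reals.
From mathcomp Require Import ring lra zify.

Set Implicit Arguments.
Unset Strict Implicit.
Unset Printing Implicit Defensive.

Import Order.TTheory GRing.Theory Num.Theory.
Local Open Scope ring_scope.

Lemma sum_even_odd (V : nmodType) (n : nat) (f : nat -> V) :
  \sum_(i < 2 * n) f i = \sum_(j < n) (f (2 * j)%N + f (2 * j).+1).
Proof.
elim: n => [|n IHn]; first by rewrite !big_ord0.
by rewrite mulnS !big_ord_recr IHn /= addrA.
Qed.

(** The numbers [(1 + t) / 2] and [(1 - t) / 2] have sum [1] and product [- g], so they are the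
    characteristic roots of the recurrence of [s]. Scaling by [2 ^+ m] avoids the denominators. *)
Lemma s_binet (K : realType) (m : nat) (t g : K) : t ^+ 2 = 1 + 4 * g ->
  2 ^+ m * s m g = (1 + t) ^+ m + (1 - t) ^+ m.
Proof.
move=> tg.
suff [] : 2 ^+ m * s m g = (1 + t) ^+ m + (1 - t) ^+ m /\
          2 ^+ m.+1 * s m.+1 g = (1 + t) ^+ m.+1 + (1 - t) ^+ m.+1 by [].
elim: m => [|m [IH0 IH1]]; first by rewrite /= !expr0 !expr1; split; ring.
split=> //.
have -> : 2 ^+ m.+2 * s m.+2 g
    = 2 * (2 ^+ m.+1 * s m.+1 g) + 4 * g * (2 ^+ m * s m g).
  by rewrite -[s m.+2 g]/(s m.+1 g + g * s m g) !exprS; ring.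
have -> : 4 * g = t ^+ 2 - 1 by rewrite tg; ring.
by rewrite IH0 IH1 !exprS; ring.
Qed.

(** With [t] the square root of [1 + 4 * g], the odd powers of [t] cancel between the two binomial
    expansions and the even ones double. *)
Lemma s_odd_binomial (K : realType) (n : nat) (g : K) : 0 <= 1 + 4 * g ->
  2 ^+ (2 * n) * s (2 * n + 1) g
  = \sum_(j < n.+1) 'C(2 * n + 1, 2 * j)%:R * (1 + 4 * g) ^+ j.
Proof.
move=> x_ge0; have tg := sqr_sqrtr x_ge0; set t := Num.sqrt _ in tg.
have two0 : (2 : K) != 0 by rewrite pnatr_eq0.
apply: (mulfI two0); rewrite mulrA -exprS -(addn1 (2 * n)) (s_binet _ tg).
rewrite !exprDn -big_split /=.
have -> : (2 * n + 1).+1 = (2 * n.+1)%N by lia.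
rewrite (sum_even_odd _ (fun i : nat =>
  1 ^+ (2 * n + 1 - i) * t ^+ i *+ 'C(2 * n + 1, i)
  + 1 ^+ (2 * n + 1 - i) * (- t) ^+ i *+ 'C(2 * n + 1, i))).
rewrite mulr_sumr; apply: eq_bigr => j _.
rewrite !expr1n !mul1r !exprS !exprM sqrrN tg mulNr mulNrn subrr addr0.
by rewrite -mulr2n -[LHS]mulr_natl -[X in 2 * X = _]mulr_natl.
Qed.

(** This belongs to the power [j.+1] of [x = 1 + 4 * g] in [collR]: the terms of power [0] cancel
    the two [- 1], which leaves a factor [x]. *)
Definition coll_coef (K : realType) (p q : nat) (b : K) (j : nat) : K :=
  b * 'C(2 * p + 1, 2 * j.+1)%:R - 'C(2 * q + 1, 2 * j.+1)%:R.

Definition coll_poly (K : realType) (p q : nat) (b : K) : {poly K} :=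
  \poly_(j < p) coll_coef p q b j.

Lemma collR_factor (K : realType) (p q : nat) (b g : K) : (q < p)%N ->
  0 <= 1 + 4 * g ->
  collR p q b g = (1 + 4 * g) * (coll_poly p q b).[1 + 4 * g].
Proof.
move=> qp x_ge0; rewrite /collR !s_odd_binomial //; move: (1 + 4 * g) => x.
have drop1 n : (n <= p)%N ->
    \sum_(j < n.+1) 'C(2 * n + 1, 2 * j)%:R * x ^+ j - 1
    = x * \sum_(j < p) 'C(2 * n + 1, 2 * j.+1)%:R * x ^+ j.
  move=> np; rewrite big_ord_recl muln0 bin0 expr0 mulr1 addrC addKr.
  rewrite (big_ord_widen p (fun j : nat =>
    'C(2 * n + 1, 2 * j.+1)%:R * x ^+ j.+1)) // big_mkcond mulr_sumr.
  apply: eq_bigr => j _; case: ifPn => [_|]; first by rewrite exprS; ring.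
  (* For [n <= j] the lower index [2 * j.+1] exceeds [2 * n + 1], so padding the sum up to [p] adds
     only zeros. *)
  by rewrite -leqNgt => nj; rewrite bin_small ?mul0r ?mulr0 //; lia.
rewrite !drop1 ?(ltnW qp) // horner_poly mulrCA -mulrBr mulr_sumr -sumrB.
by congr (_ * _); apply: eq_bigr => j _; rewrite /coll_coef; ring.
Qed.

(** The ratio of binomials two apart, cleared of denominators; for [n <= m.+1] both sides vanish
    thanks to truncated subtraction. *)
Lemma bin_add2 (n m : nat) :
  ((m.+2 * m.+1) * 'C(n, m.+2) = (n - m) * (n - m.+1) * 'C(n, m))%N.
Proof.
rewrite -mulnA mulnCA [(m.+2 * _)%N]mul_bin_left mulnCA mul_bin_left; lia.
Qed.

(* The ratio of consecutive binomials ['C(n, m + 2) / 'C(n, m)] grows with [n],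
   so ['C(2 q + 1, 2 j) / 'C(2 p + 1, 2 j)] decreases in [j]. *)
Lemma coll_coef_ge0S (K : realType) (p q : nat) (b : K) (j : nat) :
  (q < p)%N -> 0 <= b -> 0 <= coll_coef p q b j -> 0 <= coll_coef p q b j.+1.
Proof.
move=> qp b0; rewrite /coll_coef !subr_ge0 => cj.
have m2 : (2 * j.+2 = (2 * j.+1).+2)%N by lia.
rewrite m2; set m := (2 * j.+1)%N in cj *.
have k0 : 0 < (m.+2 * m.+1)%:R :> K by rewrite ltr0n.
rewrite -(ler_pM2l k0) mulrCA -!natrM !bin_add2.
rewrite natrM [X in b * X]natrM mulrCA.
apply: ler_pM => //; rewrite ?ler0n // ler_nat leq_mul //; lia.
Qed.

Lemma coll_coef_ge0_mono (K : realType) (p q : nat) (b : K) (i j : nat) :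
  (q < p)%N -> 0 <= b -> (i <= j)%N ->
  0 <= coll_coef p q b i -> 0 <= coll_coef p q b j.
Proof.
move=> qp b0 /subnK <-; elim: (j - i)%N => // k IHk ci.
by rewrite addSn; apply: coll_coef_ge0S => //; exact: IHk.
Qed.

(* With [N] the place where the coefficients change sign, every term satisfies
   [c_j x ^ j <= c_j x ^ N]. *)
Lemma coll_poly_le (K : realType) (p q : nat) (b x : K) :
  (q < p)%N -> 0 <= b -> 0 <= x <= 1 ->
  exists N, (coll_poly p q b).[x] <= x ^+ N * (coll_poly p q b).[1].
Proof.
move=> qp b0 /andP[x0 x1].
(* At index [p] both binomials are out of range, so the coefficient is [0] and a first nonnegative
   one exists. *)
have exN : exists j, 0 <= coll_coef p q b j.
  by exists p; rewrite /coll_coef !bin_small ?mulr0 ?subr0 //; lia.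
case: (ex_minnP exN) => N cN minN; exists N.
rewrite !horner_poly mulr_sumr; apply: ler_sum => j _.
rewrite expr1n mulr1 mulrC; have [Nj|jN] := leqP N j.
  by rewrite ler_wpM2r ?(coll_coef_ge0_mono qp b0 Nj) // ler_wiXn2l.
rewrite ler_wnM2r ?ler_wiXn2l ?(ltnW jN) // leNgt.
by apply/negP => /ltW /minN; rewrite leqNgt jN.
Qed.

Lemma coll_poly0 (K : realType) (p q : nat) (b : K) : (0 < p)%N ->
  (coll_poly p q b).[0] = coll_coef p q b 0.
Proof. by move=> p0; rewrite horner_coef0 coef_poly p0. Qed.

(** The point [x = 1] is [g = 0], where the recurrence makes [s] constantly [1] from index [1] on;
    no sum of binomials has to be evaluated. *)
Lemma coll_poly1 (K : realType) (p q : nat) (b : K) : (q < p)%N ->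
  (coll_poly p q b).[1] = b * (2 ^+ (2 * p) - 1) - (2 ^+ (2 * q) - 1).
Proof.
move=> qp; have s0 n : s n.+1 (0 : K) = 1.
  by elim: n => // n IHn; rewrite [s _ _]/= -/(s n.+1 0) IHn mul0r addr0.
have := @collR_factor K p q b 0 qp; rewrite mulr0 addr0 mul1r => <- //.
by rewrite /collR !addn1 !s0 !mulr1.
Qed.

Lemma coll_poly_gt0 (K : realType) (p q : nat) (b x : K) : (q < p)%N ->
  0 <= b -> 0 <= x -> 0 < coll_coef p q b 0 -> 0 < (coll_poly p q b).[x].
Proof.
case: p => // p qp b0 x0 c0; rewrite horner_poly big_ord_recl expr0 mulr1.
rewrite ltr_wpDr // sumr_ge0 // => j _; rewrite mulr_ge0 ?exprn_ge0 //.
exact: (coll_coef_ge0_mono qp b0 (leq0n _) (ltW c0)).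
Qed.

(* By Pascal's rule ['C(2 p + 1, 2 j + 4) >= 'C(2 q + 1, 2 j + 2)], so the
   coefficients of [b] shifted by one power of [x >= 1 / b] absorb the
   negative part. *)
Lemma coll_poly_large (K : realType) (p q : nat) (b x : K) : (q < p)%N ->
  0 < b -> 0 <= x -> 1 <= b * x -> 0 < (coll_poly p q b).[x].
Proof.
case: p => // p qp b0 x0 bx.
have -> : (coll_poly p.+1 q b).[x] = b * 'C(2 * p.+1 + 1, 2)%:R
  + \sum_(j < p) (b * x * 'C(2 * p.+1 + 1, 2 * j.+2)%:R
                  - 'C(2 * q + 1, 2 * j.+1)%:R) * x ^+ j.
  rewrite horner_poly /coll_coef.
  under eq_bigr do rewrite mulrBl.
  rewrite sumrB big_ord_recl [X in _ - X]big_ord_recr /=.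
  (* The top term of the [q] sum vanishes because [q <= p], so after the shift both sums have [p]
     terms. *)
  rewrite (@bin_small (2 * q + 1)) ?mul0r ?addr0; last by lia.
  rewrite expr0 mulr1 -addrA -sumrB; congr (_ + _).
  by apply: eq_bigr => j _; rewrite exprS; ring.
rewrite ltr_wpDr ?mulr_gt0 ?ltr0n ?bin_gt0 //; last by lia.
rewrite sumr_ge0 // => j _; rewrite mulr_ge0 ?exprn_ge0 // subr_ge0.
have pascal : ('C(2 * q + 1, 2 * j.+1) <= 'C(2 * p.+1 + 1, 2 * j.+2))%N.
  apply: (@leq_trans 'C((2 * q + 1).+2, (2 * j.+1).+2)).
    by rewrite binS (leq_trans _ (leq_addl _ _)) // binS leq_addl.
  have -> : (2 * j.+2 = (2 * j.+1).+2)%N by lia.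
  by apply: leq_bin2l; lia.
rewrite -[X in X <= _]mul1r; apply: ler_pM; rewrite ?ler01 ?ler0n //.
by rewrite ler_nat.
Qed.

Lemma coll_poly1_lt0 (K : realType) (p q : nat) (b : K) : (q < p)%N ->
  ((coll_poly p q b).[1] < 0) = (b < beta_zero K p q).
Proof.
move=> qp; rewrite coll_poly1 // subr_lt0 /beta_zero ltr_pdivlMr // subr_gt0.
by rewrite exprn_egt1 ?ltr1n //; lia.
Qed.

Lemma coll_poly1_gt0 (K : realType) (p q : nat) (b : K) : (q < p)%N ->
  (0 < (coll_poly p q b).[1]) = (beta_zero K p q < b).
Proof.
move=> qp; rewrite coll_poly1 // subr_gt0 /beta_zero ltr_pdivrMr // subr_gt0.
by rewrite exprn_egt1 ?ltr1n //; lia.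
Qed.

Lemma coll_coef0E (K : realType) (p q : nat) (b : K) :
  2 * coll_coef p q b 0
  = b * ((2 * p + 1) * (2 * p))%:R - ((2 * q + 1) * (2 * q))%:R.
Proof.
have b2 n : 2 * 'C(2 * n + 1, 2)%:R = ((2 * n + 1) * (2 * n))%:R :> K.
  by rewrite -natrM mul_bin_left bin1; congr (_%:R); lia.
by rewrite /coll_coef muln1 -!b2; ring.
Qed.

Lemma coll_coef0_lt0 (K : realType) (p q : nat) (b : K) : (0 < p)%N ->
  (coll_coef p q b 0 < 0) = (b < beta_quarter K p q).
Proof.
move=> p0; rewrite -(pmulr_rlt0 _ (ltr0Sn K 1)) coll_coef0E subr_lt0.
by rewrite /beta_quarter ltr_pdivlMr // ltr0n; lia.
Qed.

Lemma coll_coef0_gt0 (K : realType) (p q : nat) (b : K) : (0 < p)%N ->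
  (0 < coll_coef p q b 0) = (beta_quarter K p q < b).
Proof.
move=> p0; rewrite -(pmulr_rgt0 _ (ltr0Sn K 1)) coll_coef0E subr_gt0.
by rewrite /beta_quarter ltr_pdivrMr // ltr0n; lia.
Qed.

Lemma poly_ivt_strict (K : realType) (P : {poly K}) (u v : K) : u <= v ->
  P.[u] < 0 -> 0 < P.[v] -> exists x, [/\ u < x, x < v & P.[x] = 0].
Proof.
move=> uv Pu Pv.
have [|x /andP[ux xv] /rootP Px] := @poly_ivt K P u v uv.
  by rewrite !ltW.
exists x; split=> //; rewrite lt_neqAle.
  by rewrite ux andbT; apply: contraTneq Pu => ->; rewrite Px ltxx.
by rewrite xv andbT; apply: contraTneq Pv => <-; rewrite Px ltxx.
Qed.

Lemma collR_root (K : realType) (p q : nat) (b x : K) : (q < p)%N -> 0 < x ->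
  (coll_poly p q b).[x] = 0 -> collR p q b ((x - 1) / 4) = 0.
Proof.
move=> qp x0 Px; have xE : 1 + 4 * ((x - 1) / 4) = x by field.
by rewrite collR_factor // xE ?Px ?mulr0 // ltW.
Qed.

(** Away from the permanent root [- (1 / 4)] the factor [1 + 4 * g] is positive and can be
    cancelled. *)
Lemma collR_root_poly (K : realType) (p q : nat) (b g : K) : (q < p)%N ->
  - (1 / 4) < g -> collR p q b g = 0 -> (coll_poly p q b).[1 + 4 * g] = 0.
Proof.
move=> qp g0; have x0 : 0 < 1 + 4 * g by lra.
rewrite collR_factor ?(ltW x0) // => /eqP; rewrite mulf_eq0 gt_eqF //=.
by move/eqP.
Qed.

Theorem theorem5 (K : realType) (p q : nat) (hq : (0 < q)%N) (hpq : (q < p)%N)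
    (beta : K) (hbeta : 0 < beta) :
  [/\ beta < beta_zero K p q ->
        (exists g : K, 0 < g /\ collR p q beta g = 0) /\
        ~ (exists g : K, - (1 / 4) < g /\ g < 0 /\ collR p q beta g = 0),
      beta_zero K p q < beta -> beta < beta_quarter K p q ->
        exists g : K, - (1 / 4) < g /\ g < 0 /\ collR p q beta g = 0
    & beta_quarter K p q < beta ->
        forall g : K, collR p q beta g = 0 -> g <= - (1 / 4)].
Proof.
have p0 : (0 < p)%N by apply: leq_ltn_trans hpq.
split.
- rewrite -coll_poly1_lt0 // => P1; split.
    have bV0 : 0 < beta^-1 by rewrite invr_gt0.
    (* The right end [x = 1 + beta^-1] gives [beta * x = beta + 1], as [coll_poly_large] requires; a
       root [x > 1] means [g > 0]. *)
    have [||x [x1 _ Px]] := poly_ivt_strict _ P1 (v := 1 + beta^-1).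
    + by lra.
    + apply: coll_poly_large => //; first by lra.
      by rewrite mulrDr divff ?gt_eqF //; lra.
    by exists ((x - 1) / 4); split; [lra | apply: collR_root => //; lra].
  move=> [g [g1 [g2 /(collR_root_poly hpq g1) Pg]]].
  have x01 : 0 <= 1 + 4 * g <= 1 by apply/andP; split; lra.
  (* A root here would give [0 <= x ^+ N * P.[1]] with [x > 0], where [P] is [coll_poly p q beta],
     against [P.[1] < 0]. *)
  have [N] := coll_poly_le hpq (ltW hbeta) x01.
  by rewrite Pg pmulr_rge0 ?exprn_gt0 ?leNgt ?P1 //; lra.
- rewrite -coll_poly1_gt0 // -coll_coef0_lt0 // -coll_poly0 // => P1 P0.
  have [x [x0 x1 Px]] := poly_ivt_strict ler01 P0 P1.
  exists ((x - 1) / 4); split; first by lra.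
  by split; [lra | exact: collR_root].
rewrite -coll_coef0_gt0 // => c0 g Rg; rewrite leNgt; apply/negP => g1.
have x0 : 0 <= 1 + 4 * g by lra.
have := coll_poly_gt0 hpq (ltW hbeta) x0 c0.
by rewrite (collR_root_poly hpq g1 Rg) ltxx.
Qed.
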